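(* Let $0<\sigma\le1$ and let $F(a,b)=\operatorname{sgn}(\sigma)\,H^{\sigma}=(a+b)^{\sigma}$ for $a,b>0$, where $H=a+b$. Then there exists no maximum-principle function (MPF) for the normal velocity $F$.
   Context: Notation: $\mathbb{R}^2_+=(0,\infty)^2$; subscripts $a,b$ denote partial derivatives. Normal velocity: a symmetric function $F\in C^2(\mathbb{R}^2_+)$, homogeneous of some degree $\sigma\in\mathbb{R}\setminus\{0\}$, with $F_a,F_b>0$ for all $a,b>0$. It is contracting if $F>0$ everywhere on $\mathbb{R}^2_+$ and expanding if $F<0$ everywhere on $\mathbb{R}^2_+$. Maximum-principle function (MPF) for a normal velocity $F$: a symmetric function $w\in C^2(\mathbb{R}^2_+)$, homogeneous of some degree $\chi\in\mathbb{R}\setminus\{0\}$, such that, with $\alpha=-w_a/w_b$ and $\alpha_a=\partial\alpha/\partial a$ (defined for $a\ne b$): (1) $w>0$ whenever $a\neq b$, and $w=0$ whenever $a=b$. (2) $\chi>0$ if $F$ is contracting, $\chi<0$ if $F$ is expanding. (3) $w_a<0$ for all $0<a<b$, and $w_a>0$ for all $0<b<a$. (4) For all $a,b>0$ (for $E_w,G_w$: $a\neq b$) one has $C_w(a,b)\le0$, $E_w(a,b)\le0$, $G_w(a,b)\le 0$, where $$C_w=w_a\,a\big((F_aa^2+F_bb^2)+(F-F_aa-F_bb)a\big)+w_b\,b\big((F_aa^2+F_bb^2)+(F-F_aa-F_bb)b\big),$$ $$E_w=w_a(F_{aa}+2F_{ab}\alpha+F_{bb}\alpha^2)-F_a(w_{aa}+2w_{ab}\alpha+w_{bb}\alpha^2)+2\,\frac{w_bF_a-w_aF_b}{a-b}\,\alpha^2,$$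 $$G_w=\frac1{\alpha^2}\Big(w_b(F_{aa}+2F_{ab}\alpha+F_{bb}\alpha^2)-F_b(w_{aa}+2w_{ab}\alpha+w_{bb}\alpha^2)+2\,\frac{w_bF_a-w_aF_b}{a-b}\Big).$$ (5) There are constants $c>0$, $d\in\mathbb{R}$ such that, evaluating $\alpha$ and $\alpha_a$ at $(a,b)=(\rho,1)$ with $0<\rho<1$: if $F$ is contracting, then either $\alpha=c$ and $\alpha_a=0$ for all sufficiently small $\rho$, or, as $\rho\to0$, $\alpha=\frac c\rho+o(\rho^{-1})$ and $\alpha_a=-\frac c{\rho^2}+o(\rho^{-1})$; if $F$ is expanding, then, as $\rho\to0$, either $\alpha=\frac c\rho+o(\rho^{-1})$ and $\alpha_a=-\frac c{\rho^2}+o(\rho^{-1})$, or $\alpha=\frac{c+d\rho}{\rho^2}+o(\rho^{-1})$ and $\alpha_a=-\frac{2c+d\rho}{\rho^3}+o(\rho^{-1})$. *)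

(* Defs.v *)
From Stdlib Require Import Reals Lra.
From Coquelicot Require Import Coquelicot.

Open Scope R_scope.

(** Functions on the open quadrant (0,oo)^2 are represented by total functions
    [R -> R -> R]; every condition below is imposed at points with [0 < a] and
    [0 < b] only.  Since the quadrant is open, the partial derivatives there
    do not depend on the values taken outside. *)

Definition pd_a (f : R -> R -> R) (a b : R) : R := Derive (fun x => f x b) a.
Definition pd_b (f : R -> R -> R) (a b : R) : R := Derive (fun y => f a y) b.

(** [ex_diff_n f 2 a b]: all partial derivatives of order at most 2 exist and
    are continuous. *)
Definition C2_quadrant (f : R -> R -> R) : Prop :=
  forall a b, 0 < a -> 0 < b -> ex_diff_n f 2 a b.

Definition symmetric_quadrant (f : R -> R -> R) : Prop :=
  forall a b, 0 < a -> 0 < b -> f a b = f b a.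

Definition homogeneous_quadrant (k : R) (f : R -> R -> R) : Prop :=
  forall t a b, 0 < t -> 0 < a -> 0 < b -> f (t * a) (t * b) = Rpower t k * f a b.

Record is_normal_velocity (F : R -> R -> R) : Prop := {
  nv_C2 : C2_quadrant F;
  nv_symmetric : symmetric_quadrant F;
  nv_homogeneous : exists s : R, s <> 0 /\ homogeneous_quadrant s F;
  nv_pd_a_pos : forall a b, 0 < a -> 0 < b -> 0 < pd_a F a b;
  nv_pd_b_pos : forall a b, 0 < a -> 0 < b -> 0 < pd_b F a b
}.

Record normal_velocity : Type := NormalVelocity {
  velocity :> R -> R -> R;
  velocityP : is_normal_velocity velocity
}.

Definition contracting (F : normal_velocity) : Prop :=
  forall a b, 0 < a -> 0 < b -> 0 < F a b.

Definition expanding (F : normal_velocity) : Prop :=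
  forall a b, 0 < a -> 0 < b -> F a b < 0.

Definition alpha (w : R -> R -> R) (a b : R) : R := - pd_a w a b / pd_b w a b.

Definition alpha_a (w : R -> R -> R) : R -> R -> R := pd_a (alpha w).

(** [f_aa + 2 f_ab alpha + f_bb alpha^2], with [alpha] that of [w]. *)
Definition second_along (w f : R -> R -> R) (a b : R) : R :=
  pd_a (pd_a f) a b + 2 * pd_b (pd_a f) a b * alpha w a b
  + pd_b (pd_b f) a b * (alpha w a b) ^ 2.

Definition C_term (F w : R -> R -> R) (a b : R) : R :=
  let Fa := pd_a F a b in
  let Fb := pd_b F a b in
  pd_a w a b * a *
    ((Fa * a ^ 2 + Fb * b ^ 2) + (F a b - Fa * a - Fb * b) * a)
  + pd_b w a b * b *
    ((Fa * a ^ 2 + Fb * b ^ 2) + (F a b - Fa * a - Fb * b) * b).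

Definition E_term (F w : R -> R -> R) (a b : R) : R :=
  pd_a w a b * second_along w F a b
  - pd_a F a b * second_along w w a b
  + 2 * ((pd_b w a b * pd_a F a b - pd_a w a b * pd_b F a b) / (a - b))
    * (alpha w a b) ^ 2.

Definition G_term (F w : R -> R -> R) (a b : R) : R :=
  / (alpha w a b) ^ 2 *
  (pd_b w a b * second_along w F a b
   - pd_b F a b * second_along w w a b
   + 2 * ((pd_b w a b * pd_a F a b - pd_a w a b * pd_b F a b) / (a - b))).

(** [f rho = g rho + o(rho^-1)] as [rho -> 0+]. *)
Definition eq_o_inv (f g : R -> R) : Prop :=
  is_domin (at_right 0) (fun rho : R => / rho) (fun rho : R => f rho - g rho).

Definition asympt_const (w : R -> R -> R) (c : R) : Prop :=
  at_right 0 (fun rho => alpha w rho 1 = c /\ alpha_a w rho 1 = 0).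

Definition asympt_order1 (w : R -> R -> R) (c : R) : Prop :=
  eq_o_inv (fun rho => alpha w rho 1) (fun rho => c / rho) /\
  eq_o_inv (fun rho => alpha_a w rho 1) (fun rho => - (c / rho ^ 2)).

Definition asympt_order2 (w : R -> R -> R) (c d : R) : Prop :=
  eq_o_inv (fun rho => alpha w rho 1) (fun rho => (c + d * rho) / rho ^ 2) /\
  eq_o_inv (fun rho => alpha_a w rho 1)
           (fun rho => - ((2 * c + d * rho) / rho ^ 3)).

Record is_MPF_of_degree (F : normal_velocity) (chi : R) (w : R -> R -> R)
    : Prop := {
  mpf_C2 : C2_quadrant w;
  mpf_symmetric : symmetric_quadrant w;
  mpf_degree_neq0 : chi <> 0;
  mpf_homogeneous : homogeneous_quadrant chi w;
  mpf_pos : forall a b, 0 < a -> 0 < b -> a <> b -> 0 < w a b;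
  mpf_diag : forall a, 0 < a -> w a a = 0;
  mpf_degree_contracting : contracting F -> 0 < chi;
  mpf_degree_expanding : expanding F -> chi < 0;
  mpf_pd_a_neg : forall a b, 0 < a -> a < b -> pd_a w a b < 0;
  mpf_pd_a_pos : forall a b, 0 < b -> b < a -> 0 < pd_a w a b;
  mpf_C : forall a b, 0 < a -> 0 < b -> C_term F w a b <= 0;
  mpf_E : forall a b, 0 < a -> 0 < b -> a <> b -> E_term F w a b <= 0;
  mpf_G : forall a b, 0 < a -> 0 < b -> a <> b -> G_term F w a b <= 0;
  mpf_asympt : exists c d : R, 0 < c /\
    (contracting F -> asympt_const w c \/ asympt_order1 w c) /\
    (expanding F -> asympt_order1 w c \/ asympt_order2 w c d)
}.

Definition is_MPF (F : normal_velocity) (w : R -> R -> R) : Prop :=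
  exists chi : R, is_MPF_of_degree F chi w.

(** The power [sgn(sigma) (a+b)^sigma] is a normal velocity, so the hypothesis
    prescribing the values of a [normal_velocity] by it is satisfiable. *)

Lemma is_derive_sum_pow (K t c x : R) : 0 < x + c ->
  is_derive (fun u : R => K * Rpower (u + c) t) x (K * t * Rpower (x + c) (t - 1)).
Proof.
intros h.
assert (hp : is_derive (fun s => Rpower s t) (x + c) (t * Rpower (x + c) (t - 1))).
{ apply is_derive_Reals. apply derivable_pt_lim_power. exact h. }
assert (hs : is_derive (fun u : R => u + c) x 1) by (auto_derive; trivial; ring).
pose proof (is_derive_scal _ _ K _ (is_derive_comp _ _ _ _ _ hp hs)) as hd.
replace (K * t * Rpower (x + c) (t - 1))
  with (K * scal 1 (t * Rpower (x + c) (t - 1))); [exact hd|].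
unfold scal; simpl; unfold mult; simpl; ring.
Qed.

Lemma is_derive_sum_pow_r (K t c x : R) : 0 < c + x ->
  is_derive (fun u : R => K * Rpower (c + u) t) x (K * t * Rpower (c + x) (t - 1)).
Proof.
rewrite Rplus_comm; intros h.
apply is_derive_ext with (fun u : R => K * Rpower (u + c) t).
- intros u; now rewrite Rplus_comm.
- now apply is_derive_sum_pow.
Qed.

Lemma locally_2d_quadrant (P : R -> R -> Prop) (a b : R) : 0 < a -> 0 < b ->
  (forall u v, 0 < u -> 0 < v -> P u v) -> locally_2d P a b.
Proof.
intros ha hb hP.
assert (hm : 0 < Rmin a b) by now apply Rmin_pos.
exists (mkposreal _ hm); simpl; intros u v hu hv.
apply Rabs_def2 in hu; apply Rabs_def2 in hv.
pose proof (Rmin_l a b); pose proof (Rmin_r a b).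
apply hP; lra.
Qed.

Lemma ex_diff_n_sum_pow (n : nat) : forall K t a b, 0 < a -> 0 < b ->
  ex_diff_n (fun u v => K * Rpower (u + v) t) n a b.
Proof.
induction n as [|n IH]; intros K t a b ha hb.
all: assert (hc : continuity_2d_pt (fun u v => K * Rpower (u + v) t) a b).
1, 3: apply (continuity_1d_2d_pt_comp (fun s => K * Rpower s t)
               (fun u v => u + v));
  [ apply continuity_pt_filterlim;
    apply (ex_derive_continuous (fun s => K * Rpower s t));
    exists (K * t * Rpower (a + b) (t - 1));
    apply (is_derive_ext (fun s : R => K * Rpower (s + 0) t));
      [intros s; now rewrite Rplus_0_r|];
    rewrite <- (Rplus_0_r (a + b)) at 2;
    apply is_derive_sum_pow; lra
  | apply continuity_2d_pt_plus;
      [apply continuity_2d_pt_id1 | apply continuity_2d_pt_id2] ].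
- now split.
- split; [exact hc|]; split; [|split; [|split]].
  + eexists; apply is_derive_sum_pow; lra.
  + eexists; apply is_derive_sum_pow_r; lra.
  + apply ex_diff_n_ext_loc with (fun u v => K * t * Rpower (u + v) (t - 1)).
    * apply locally_2d_quadrant; try assumption; intros u v hu hv.
      symmetry; apply is_derive_unique, is_derive_sum_pow; lra.
    * now apply IH.
  + apply ex_diff_n_ext_loc with (fun u v => K * t * Rpower (u + v) (t - 1)).
    * apply locally_2d_quadrant; try assumption; intros u v hu hv.
      symmetry; apply is_derive_unique, is_derive_sum_pow_r; lra.
    * now apply IH.
Qed.

Lemma sum_pow_is_normal_velocity (sigma : R) : sigma <> 0 ->
  is_normal_velocity (fun a b => sign sigma * Rpower (a + b) sigma).
Proof.
intros hs.
assert (hpos : forall s, 0 < sign sigma * sigma * Rpower s (sigma - 1)).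
{ intros s; apply Rmult_lt_0_compat; [|apply exp_pos].
  destruct (Rlt_or_le 0 sigma) as [h|h].
  - rewrite sign_eq_1; lra.
  - rewrite sign_eq_m1; lra. }
split.
- intros a b ha hb; now apply ex_diff_n_sum_pow.
- intros a b _ _; now rewrite Rplus_comm.
- exists sigma; split; [exact hs|]; intros t a b ht ha hb.
  rewrite <- Rmult_plus_distr_l, <- Rpower_mult_distr by lra; ring.
- intros a b ha hb; unfold pd_a.
  rewrite (is_derive_unique _ _ _ (is_derive_sum_pow (sign sigma) sigma b a ltac:(lra))).
  apply hpos.
- intros a b ha hb; unfold pd_b.
  rewrite (is_derive_unique _ _ _ (is_derive_sum_pow_r (sign sigma) sigma a b ltac:(lra))).
  apply hpos.
Qed.

(* Main.v *)
(** At a point with [0 < a < b], Euler's relation [a w_a + b w_b = chi w] gives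
    [a w_a + b w_b > 0] because [chi > 0], while [a w_a < 0].  For [F = H^sigma]
    one has [C_w = H^(sigma-1) (a w_a P + b w_b Q)] with
    [P = a^2 + (1-sigma) a b + sigma b^2] and
    [Q = sigma a^2 + (1-sigma) a b + b^2].  If [sigma <= 1] then
    [0 < P <= Q], so [C_w >= H^(sigma-1) P (a w_a + b w_b) > 0], contradicting
    [C_w <= 0].  It suffices to look at the point [(1,2)]. *)

Require Import Defs.
From Stdlib Require Import Reals.
From Coquelicot Require Import Coquelicot.
From Stdlib Require Import Lra.
Open Scope R_scope.

(** Existence of [pd_a f] near the point with continuity there, plus existence of [pd_b f] at the
    point, already forces joint differentiability, which the chain rule below requires. *)
Lemma C2_differentiable (f : R -> R -> R) (a b : R) :
  C2_quadrant f -> 0 < a -> 0 < b ->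
  differentiable_pt_lim f a b (pd_a f a b) (pd_b f a b).
Proof.
intros hf ha hb.
apply filterdiff_differentiable_pt_lim.
apply (is_derive_filterdiff f a b (pd_a f)).
- apply (proj1 (locally_2d_locally
    (fun u v => is_derive (fun z => f z v) u (pd_a f u v)) a b)).
  apply locally_2d_quadrant; try assumption.
  intros u v hu hv; apply Derive_correct; now apply (hf u v).
- apply Derive_correct; now apply (hf a b).
- apply (continuity_2d_pt_filterlim (pd_a f)).
  exact (proj1 (ex_diff_n_deriv_aux1 _ _ _ _ (hf a b ha hb))).
Qed.

(** The map [t => f (t * a) (t * b)] is differentiated at [t = 1] twice: by the chain rule, and as a
    multiple of [t^k]. *)
Lemma euler_relation (k : R) (f : R -> R -> R) (a b : R) :
  C2_quadrant f -> homogeneous_quadrant k f -> 0 < a -> 0 < b ->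
  pd_a f a b * a + pd_b f a b * b = k * f a b.
Proof.
intros hC2 hf ha hb.
assert (hcomp : is_derive (fun t => f (t * a) (t * b)) 1
                  (pd_a f a b * a + pd_b f a b * b)).
{ apply is_derive_Reals.
  apply (derivable_pt_lim_comp_2d f (fun t => t * a) (fun t => t * b)).
  - rewrite !Rmult_1_l; now apply C2_differentiable.
  - apply is_derive_Reals; auto_derive; trivial; ring.
  - apply is_derive_Reals; auto_derive; trivial; ring. }
rewrite <- (is_derive_unique _ _ _ hcomp).
apply is_derive_unique.
(* Homogeneity holds for [t > 0] only, hence a local replacement, on the ball of radius 1 about 1.
   The summand 0 matches [is_derive_sum_pow]. *)
apply is_derive_ext_loc with (fun t => f a b * Rpower (t + 0) k).
- exists (mkposreal 1 Rlt_0_1); intros t ht.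
  apply Rabs_def2 in ht; simpl in ht; unfold minus, plus, opp in ht; simpl in ht.
  rewrite hf, Rplus_0_r by lra; apply Rmult_comm.
- replace (k * f a b) with (f a b * k * Rpower (1 + 0) (k - 1)).
  + apply is_derive_sum_pow; lra.
  + rewrite Rplus_0_r; unfold Rpower; rewrite ln_1, Rmult_0_r, exp_0; ring.
Qed.

Lemma pd_a_sum_pow (K t : R) (f : R -> R -> R) (a b : R) :
  (forall u v, 0 < u -> 0 < v -> f u v = K * Rpower (u + v) t) ->
  0 < a -> 0 < b -> pd_a f a b = K * t * Rpower (a + b) (t - 1).
Proof.
intros hf ha hb; apply is_derive_unique.
apply is_derive_ext_loc with (fun u => K * Rpower (u + b) t).
- apply locally_2d_1d_const_y with (P := fun u v => K * Rpower (u + v) t = f u v).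
  apply locally_2d_quadrant; try assumption.
  intros u v hu hv; now rewrite hf.
- apply is_derive_sum_pow; lra.
Qed.

Lemma pd_b_sum_pow (K t : R) (f : R -> R -> R) (a b : R) :
  (forall u v, 0 < u -> 0 < v -> f u v = K * Rpower (u + v) t) ->
  0 < a -> 0 < b -> pd_b f a b = K * t * Rpower (a + b) (t - 1).
Proof.
intros hf ha hb.
(* By conversion, [pd_b f a b] is [pd_a] of the transposed function at [(b, a)]. *)
rewrite Rplus_comm.
apply (pd_a_sum_pow K t (fun u v => f v u) b a); try assumption.
intros u v hu hv; rewrite hf, Rplus_comm; trivial.
Qed.

Theorem theorem8p2 (sigma : R) (F : normal_velocity)
    (sigma_gt0 : 0 < sigma) (sigma_le1 : sigma <= 1)
    (F_eq : forall a b : R, 0 < a -> 0 < b ->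
       F a b = sign sigma * Rpower (a + b) sigma) :
  ~ exists w : R -> R -> R, is_MPF F w.
Proof.
intros [w [chi hw]].
assert (F_eq1 : forall a b, 0 < a -> 0 < b -> F a b = 1 * Rpower (a + b) sigma).
{ intros a b ha hb; rewrite F_eq, sign_eq_1 by assumption; ring. }
assert (hchi : 0 < chi).
{ apply (mpf_degree_contracting _ _ _ hw); intros a b ha hb.
  rewrite F_eq1, Rmult_1_l by assumption; apply exp_pos. }
assert (hE : 0 < pd_a w 1 2 * 1 + pd_b w 1 2 * 2).
{ rewrite (euler_relation chi) by
    (apply (mpf_C2 _ _ _ hw) || apply (mpf_homogeneous _ _ _ hw) || lra).
  apply Rmult_lt_0_compat; [exact hchi|].
  apply (mpf_pos _ _ _ hw); lra. }
assert (ha : pd_a w 1 2 < 0) by (apply (mpf_pd_a_neg _ _ _ hw); lra).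
pose proof (mpf_C _ _ _ hw 1 2 ltac:(lra) ltac:(lra)) as hC.
unfold C_term in hC.
rewrite (pd_a_sum_pow _ _ _ _ _ F_eq1), (pd_b_sum_pow _ _ _ _ _ F_eq1),
  F_eq1 in hC by lra.
set (p := Rpower (1 + 2) (sigma - 1)) in hC.
assert (hp : 0 < p) by apply exp_pos.
assert (hpow : Rpower (1 + 2) sigma = (1 + 2) * p).
{ unfold p; rewrite <- (Rpower_1 (1 + 2)) at 2 by lra.
  rewrite <- Rpower_plus; f_equal; ring. }
rewrite hpow in hC.
set (wa := pd_a w 1 2) in *; set (wb := pd_b w 1 2) in *.
(* This is [C_term F w 1 2] divided by [p], with [P = 3 + 2 * sigma] and [Q = 6 - sigma]. It equals
   [(6 - sigma) * (wa + 2 * wb) - 3 * (1 - sigma) * wa], where the first product is positive and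
   [wa < 0]. *)
assert (hbracket : 0 < wa * (3 + 2 * sigma) + 2 * wb * (6 - sigma)) by nra.
pose proof (Rmult_lt_0_compat _ _ hp hbracket).
lra.
Qed.
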